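(* Let $\mathcal{L}$ be a normal modal language satisfying the $\mathsf{S4}$ axioms, let $\mathcal{T}$ be the class of topological spaces, and let $X \in \mathcal{T}$ be arbitrary. For any formula $\varphi \in \mathcal{L}$, let $\mathcal{O}_\varphi \subseteq X$ denote the set of points where $\varphi$ is satisfied, which is interpreted as an open set if $\varphi$ is of the form $\Box\psi$, or as a closed set if $\varphi$ is of the form $\Diamond\psi$. Then $$\Box\varphi = \mathrm{int}(\mathcal{O}_\varphi), \qquad \Diamond\varphi = \mathrm{cl}(\mathcal{O}_\varphi).$$ If $\varphi$ is derivable in $\mathsf{S4}$, then for every topological space in $\mathcal{T}$, $\mathcal{O}_\varphi$ satisfies the interpretations of $\Box\varphi$ and $\Diamond\varphi$. Conversely, if $\mathcal{O}_\varphi$ satisfies the interpretations of $\Box\varphi$ and $\Diamond\varphi$ in every topological space in $\mathcal{T}$, then $\varphi$ is derivable in $\mathsf{S4}$.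
   Context: Modal formulas are generated by the grammar $\varphi ::= p \mid \bot \mid \neg\varphi \mid \varphi\wedge\psi \mid \varphi\vee\psi \mid \varphi\to\psi \mid \Diamond\varphi \mid \Box\varphi$, where $p$ ranges over atomic formulas, and $\Diamond\varphi = \neg\Box\neg\varphi$. A normal modal logic (or normal modal language) is a set $\mathcal{L}$ of modal formulas that contains all propositional tautologies and all instances of $\Box(\varphi\to\psi)\to(\Box\varphi\to\Box\psi)$, and satisfies the necessitation rule: if $\varphi$ is a theorem of $\mathcal{L}$, then so is $\Box\varphi$. It satisfies the $\mathsf{S4}$ axioms if in addition it has $\Box\varphi\to\varphi$ and $\Box\varphi\to\Box\Box\varphi$ for all $\varphi \in \mathcal{L}$; $\mathsf{S4}$ is the normal modal logic given by these axioms, and a formula is derivable in $\mathsf{S4}$ if it is a theorem of it. For a subset $A$ of a topological space $X$, $\mathrm{int}(A)$ is the largest open subset of $X$ contained in $A$, and $\mathrm{cl}(A)$ is the smallest closed subset of $X$ containing $A$. A point satisfies $\neg\varphi$ iff it does not satisfy $\varphi$, and satisfies $\varphi\to\psi$ iff it does not satisfy $\varphi$ or it satisfies $\psi$; the other propositional connectives are read classically, and the set of points satisfying an atomic formula is assigned directly. The ''interpretations of $\Box\varphi$ and $\Diamond\varphi$'' are the two displayed identifications: $\Box\varphi$ is interpreted as the set $\mathrm{int}(\mathcal{O}_\varphi)$ and $\Diamond\varphi$ as the set $\mathrm{cl}(\mathcal{O}_\varphi)$.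
   Formalization: ''Satisfies the interpretations'' also requires int(O_φ)=cl(O_φ)=X (truth at every point, all assignments), as the two identifications hold for every φ, even ⊥, and the converse would fail; modus ponens is added to the logics, and the S4 axioms range over all formulas. *)

(* Defs.v *)
(* MathComp-Analysis *)
From HB Require Import structures.
From mathcomp Require Import all_boot all_order.
From mathcomp Require Import boolp classical_sets topology.

Set Implicit Arguments.
Unset Strict Implicit.
Unset Printing Implicit Defensive.

Local Open Scope classical_set_scope.

Inductive formula (Atom : Type) : Type :=
| Var of Atom
| Bot
| Neg of formula Atom
| And of formula Atom & formula Atom
| Or of formula Atom & formula Atom
| Imp of formula Atom & formula Atom
| Box of formula Atom.

Arguments Bot {Atom}.

(* The equation Dia phi = Neg (Box (Neg phi)) is an identity of formulas: the
   logics below have no separate axiom relating Dia and Box. *)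
Definition Dia (Atom : Type) (phi : formula Atom) : formula Atom :=
  Neg (Box (Neg phi)).

(* Truth-table evaluation; a boxed formula is opaque and receives an arbitrary
   truth value from w. *)
Fixpoint truth_value (Atom : Type) (v : Atom -> bool)
    (w : formula Atom -> bool) (phi : formula Atom) : bool :=
  match phi with
  | Var p => v p
  | Bot => false
  | Neg a => ~~ truth_value v w a
  | And a b => truth_value v w a && truth_value v w b
  | Or a b => truth_value v w a || truth_value v w b
  | Imp a b => truth_value v w a ==> truth_value v w b
  | Box a => w a
  end.

Definition tautology (Atom : Type) (phi : formula Atom) : Prop :=
  forall v w, truth_value v w phi.

(* L is the set of theorems. Closure under modus ponens belongs to the notion
   of theorem; consistency is not required, so the set of all formulas is a
   normal logic. *)
Record normal_logic (Atom : Type) (L : set (formula Atom)) : Prop := {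
  normal_taut : forall phi, tautology phi -> L phi;
  normal_K : forall phi psi,
    L (Imp (Box (Imp phi psi)) (Imp (Box phi) (Box psi)));
  normal_mp : forall phi psi, L (Imp phi psi) -> L phi -> L psi;
  normal_nec : forall phi, L phi -> L (Box phi)
}.

Record S4_axioms (Atom : Type) (L : set (formula Atom)) : Prop := {
  S4_axiom_T : forall phi, L (Imp (Box phi) phi);
  S4_axiom_4 : forall phi, L (Imp (Box phi) (Box (Box phi)))
}.

Inductive S4 (Atom : Type) : formula Atom -> Prop :=
| S4_taut phi : tautology phi -> S4 phi
| S4_K phi psi : S4 (Imp (Box (Imp phi psi)) (Imp (Box phi) (Box psi)))
| S4_T phi : S4 (Imp (Box phi) phi)
| S4_4 phi : S4 (Imp (Box phi) (Box (Box phi)))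
| S4_mp phi psi : S4 (Imp phi psi) -> S4 phi -> S4 psi
| S4_nec phi : S4 phi -> S4 (Box phi).

Lemma S4_least (Atom : Type) :
  [/\ normal_logic (@S4 Atom), S4_axioms (@S4 Atom) &
      forall L : set (formula Atom),
        normal_logic L -> S4_axioms L -> @S4 Atom `<=` L].
Proof.
split; [split| split|]; try by constructor.
  exact: S4_mp.
move=> L [taut K mp nec] [T4 four] phi.
elim=> [?|?|?|?|? ? _ H1 _ H2|?]; auto.
exact: mp H1 H2.
Qed.

Fixpoint truth_set (Atom : Type) (X : topologicalType) (V : Atom -> set X)
    (phi : formula Atom) : set X :=
  match phi with
  | Var p => V p
  | Bot => set0
  | Neg a => ~` truth_set V a
  | And a b => truth_set V a `&` truth_set V b
  | Or a b => truth_set V a `|` truth_set V b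
  | Imp a b => ~` truth_set V a `|` truth_set V b
  | Box a => interior (truth_set V a)
  end.

(* Box phi and Dia phi are interpreted as interior and closure, and, so
   interpreted, both are satisfied at every point. The identifications alone
   hold for every formula and could not characterize derivability. *)
Definition satisfies_interpretations (Atom : Type) (X : topologicalType)
    (V : Atom -> set X) (phi : formula Atom) : Prop :=
  [/\ truth_set V (Box phi) = interior (truth_set V phi),
      truth_set V (Dia phi) = closure (truth_set V phi),
      interior (truth_set V phi) = setT &
      closure (truth_set V phi) = setT].

(* Main.v *)
Require Import Defs.
From HB Require Import structures.
From mathcomp Require Import all_boot all_order.
From mathcomp Require Import boolp classical_sets topology.

Set Implicit Arguments.
Unset Strict Implicit.
Unset Printing Implicit Defensive.

Local Open Scope classical_set_scope.

(** Soundness is an induction on derivations: the truth set of a theorem is the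
whole space, because interior preserves the whole space, commutes with binary
intersections, shrinks sets and is idempotent; this matches necessitation, K, T
and 4 one by one. A set equal to the whole space has interior and closure equal
to it.

Completeness uses a canonical topological model. Its points are the complete
theories that contain the logic. The point [v] is accessible from [w] when it
contains every [a] with [Box a] in [w]; axioms T and 4 make this relation a
preorder. The open sets are the sets closed under accessibility. In the topology
of a preorder a point is interior to [A] exactly when every point accessible
from it lies in [A] ([canonical_interiorE]), so the topological reading of [Box]
agrees with the relational one. Hence a point satisfies exactly the formulas it
contains ([truth_lemma]); the modal step needs, for each [w] not containing
[Box a], an accessible point not containing [a] ([box_witness]). A formula
outside the logic is omitted by some complete theory containing the logic, so it
fails at a point of this one space.

Both uses of a theory omitting a given formula come from [lindenbaum]: a theory
maximal among those omitting [phi] decides every formula. Deciding relative to a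
fixed omitted [phi], and taking closure under modus ponens as part of being a
theory, avoids any calculus of derivations from finite sets of premises. *)

(** * Soundness *)

(** Each point of a space induces a propositional valuation that treats boxed
formulas as atoms; this is why tautologies hold at every point. *)
Lemma truth_valueE (Atom : Type) (X : topologicalType) (V : Atom -> set X)
    (x : X) (phi : formula Atom) :
  truth_value (fun p => `[< V p x >])
    (fun a => `[< interior (truth_set V a) x >]) phi =
  `[< truth_set V phi x >].
Proof.
elim: phi => [p||a IHa|a IHa b IHb|a IHa b IHb|a IHa b IHb|a _] //=.
- by symmetry; apply/asboolP.
- by rewrite IHa -asbool_neg.
- by rewrite IHa IHb -asbool_and.
- by rewrite IHa IHb -asbool_or.
- by rewrite IHa IHb implybE -asbool_neg -asbool_or.
Qed.

Lemma soundness (Atom : Type) (X : topologicalType) (V : Atom -> set X)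
    (phi : formula Atom) : S4 phi -> truth_set V phi = setT.
Proof.
elim=> {phi} [phi taut|a b|a|a|a b _ IHab _ IHa|a _ IHa].
- apply/seteqP; split=> // x _.
  by apply/asboolP; rewrite -truth_valueE; exact: taut.
- apply/seteqP; split=> // x _ /=.
  have [Kx|] := pselect ((~` truth_set V a `|` truth_set V b)° x); last by left.
  right; have [ax|] := pselect ((truth_set V a)° x); last by left.
  right; have : ((~` truth_set V a `|` truth_set V b) `&` truth_set V a)° x.
    by rewrite interiorI; split.
  by apply: interiorS => y [[]].
- apply/seteqP; split=> // x _ /=.
  by have [/interior_subset|] := pselect ((truth_set V a)° x); [right|left].
- apply/seteqP; split=> // x _ /=.
  have /interior_id -> := open_interior (truth_set V a).
  by have [|] := pselect ((truth_set V a)° x); [right|left].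
- by move: IHab; rewrite /= IHa setCT set0U.
- by rewrite /= IHa interiorT.
Qed.

Lemma truth_set_Dia (Atom : Type) (X : topologicalType) (V : Atom -> set X)
    (phi : formula Atom) : truth_set V (Dia phi) = closure (truth_set V phi).
Proof. by rewrite /= interiorC setCK. Qed.

(** * Complete theories *)

Record theory (Atom : Type) (T : set (formula Atom)) : Prop := {
  theory_taut : forall phi, tautology phi -> T phi;
  theory_mp : forall phi psi, T (Imp phi psi) -> T phi -> T psi
}.

Record complete_theory (Atom : Type) (T : set (formula Atom)) : Prop := {
  complete_is_theory : theory T;
  complete_Neg : forall phi, T (Neg phi) <-> ~ T phi
}.

Ltac taut_by_cases := by move=> ? ? /=; do ?case: truth_value.

(** By the deduction theorem this is the theory generated by [T] and [a]; taking
it as a definition reduces closure under modus ponens to a tautology. *)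
Definition extend_theory (Atom : Type) (T : set (formula Atom))
    (a : formula Atom) : set (formula Atom) := [set b | T (Imp a b)].

Lemma extend_theory_theory (Atom : Type) (T : set (formula Atom))
    (a : formula Atom) : theory T -> theory (extend_theory T a).
Proof.
move=> thT; split=> [b taut|b c Tabc Tab].
  apply: (theory_taut thT) => v w /=.
  by rewrite taut implybT.
have taut : tautology (Imp (Imp a (Imp b c)) (Imp (Imp a b) (Imp a c))).
  by taut_by_cases.
exact: (theory_mp thT (theory_mp thT (theory_taut thT taut) Tabc) Tab).
Qed.

Lemma sub_extend_theory (Atom : Type) (T : set (formula Atom))
    (a : formula Atom) : theory T -> T `<=` extend_theory T a.
Proof.
move=> thT b; apply: (theory_mp thT); apply: (theory_taut thT).
by taut_by_cases.
Qed.

Lemma extend_theory_self (Atom : Type) (T : set (formula Atom))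
    (a : formula Atom) : theory T -> extend_theory T a a.
Proof. by move=> thT; apply: (theory_taut thT); taut_by_cases. Qed.

(** Two incomparable chain members would be needed for modus ponens to fail in
the union, so Zorn applies; a maximal theory omitting [phi] is complete because
a formula outside it must imply [phi], so if both [a] and [Neg a] were outside,
[phi] would follow by cases. *)
Lemma lindenbaum (Atom : Type) (G : set (formula Atom)) (phi : formula Atom) :
  theory G -> ~ G phi ->
  exists T, [/\ complete_theory T, G `<=` T & ~ T phi].
Proof.
move=> thG nGphi.
(* The union of the empty chain is empty, so the empty set has to qualify. *)
pose P (T : set (formula Atom)) :=
  T !=set0 -> [/\ theory T, G `<=` T & ~ T phi].
have [F FP totF|T [PT maxT]] := @Zorn_bigcup _ P.
  case=> d [X FX Xd]; split.
  - have [[tautX _] _ _] := FP _ FX (ex_intro _ d Xd).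
    split=> [a /tautX Xa|a b [Y FY Yab] [Z FZ Za]]; first by exists X.
    have [YZ|ZY] := totF _ _ FY FZ.
      have [thZ _ _] := FP _ FZ (ex_intro _ a Za).
      by exists Z => //; exact: (theory_mp thZ (YZ _ Yab) Za).
    have [thY _ _] := FP _ FY (ex_intro _ _ Yab).
    by exists Y => //; exact: (theory_mp thY Yab (ZY _ Za)).
  - by have [_ GX _] := FP _ FX (ex_intro _ d Xd) => a /GX Xa; exists X.
  - by case=> Y FY Yphi; have [_ _] := FP _ FY (ex_intro _ _ Yphi).
have T0 : T !=set0.
  apply: contrapT => nT.
  have PG : P G by move=> _; split.
  apply: (maxT G _ PG); split; first by move=> a Ta; case: nT; exists a.
  move=> GT; apply: nT; exists (Imp phi phi); apply: GT.
  exact: extend_theory_self.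
have [thT GT nTphi] := PT T0; exists T; split=> //; split=> // a.
have Tmp := theory_mp thT; have Ttaut := theory_taut thT.
have implies_phi b : ~ T b -> T (Imp b phi).
  move=> nTb; apply: contrapT => nTbphi.
  apply: (maxT (extend_theory T b)).
    split; first exact: sub_extend_theory.
    by move=> /(_ _ (extend_theory_self b thT)).
  move=> _; split=> //; first exact: extend_theory_theory.
  exact: subset_trans GT (sub_extend_theory b thT).
split=> [TNa Ta|nTa].
  apply/nTphi/(Tmp _ _ _ Ta)/(Tmp _ _ _ TNa)/Ttaut.
  by taut_by_cases.
apply: contrapT => nTNa; apply: nTphi.
apply: (Tmp _ _ _ (implies_phi _ nTNa)); apply: (Tmp _ _ _ (implies_phi _ nTa)).
by apply: Ttaut; taut_by_cases.
Qed.

Section complete_theory_connectives.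
Context {Atom : Type} {T : set (formula Atom)} (cT : complete_theory T).

Let Tmp := theory_mp (complete_is_theory cT).
Let Ttaut := theory_taut (complete_is_theory cT).

Lemma complete_Bot : ~ T Bot.
Proof. by apply/(complete_Neg cT)/Ttaut. Qed.

Lemma complete_And a b : T (And a b) <-> T a /\ T b.
Proof.
split=> [Tab|[Ta Tb]].
  by split; apply: Tmp Tab; apply: Ttaut; taut_by_cases.
by apply: Tmp Tb; apply: Tmp Ta; apply: Ttaut; taut_by_cases.
Qed.

Lemma complete_Or a b : T (Or a b) <-> T a \/ T b.
Proof.
split=> [Tab|[Ta|Tb]].
- have [|/(complete_Neg cT) TNa] := pselect (T a); first by left.
  by right; apply: Tmp TNa; apply: Tmp Tab; apply: Ttaut; taut_by_cases.
- by apply: Tmp Ta; apply: Ttaut; taut_by_cases.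
- by apply: Tmp Tb; apply: Ttaut; taut_by_cases.
Qed.

Lemma complete_Imp a b : T (Imp a b) <-> ~ T a \/ T b.
Proof.
split=> [Tab|[/(complete_Neg cT) TNa|Tb]].
- by have [/(Tmp Tab)|] := pselect (T a); [right|left].
- by apply: Tmp TNa; apply: Ttaut; taut_by_cases.
- by apply: Tmp Tb; apply: Ttaut; taut_by_cases.
Qed.

End complete_theory_connectives.

(** * The canonical space *)

Record canonical_point (Atom : Type) (L : set (formula Atom)) : Type := {
  point_theory :> formula Atom -> Prop;
  point_complete : complete_theory point_theory;
  point_logic : L `<=` point_theory
}.

Definition accessible (Atom : Type) (L : set (formula Atom))
  (w v : canonical_point L) : Prop := forall a, w (Box a) -> v a.

Definition upward_closed (Atom : Type) (L : set (formula Atom))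
  (U : set (canonical_point L)) : Prop :=
  forall w v, accessible w v -> U w -> U v.

Section canonical_topology.
Variables (Atom : Type) (L : set (formula Atom)).

HB.instance Definition _ := gen_eqMixin (canonical_point L).
HB.instance Definition _ := gen_choiceMixin (canonical_point L).

Let upward_closedT : upward_closed (@setT (canonical_point L)).
Proof. by []. Qed.

Let upward_closedI : setI_closed (@upward_closed Atom L).
Proof. by move=> A B cA cB w v wv [Aw Bw]; split; [apply: cA Aw|apply: cB Bw]. Qed.

Let upward_closed_bigU (I : Type) (f : I -> set (canonical_point L)) :
  (forall i, upward_closed (f i)) -> upward_closed (\bigcup_i f i).
Proof. by move=> cf w v wv [i _ fw]; exists i => //; apply: cf fw. Qed.

HB.instance Definition _ := isOpenTopological.Build (canonical_point L)
  upward_closedT upward_closedI upward_closed_bigU.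

End canonical_topology.

Section canonical_model.
Variables (Atom : Type) (L : set (formula Atom)).
Hypotheses (L_normal : normal_logic L) (L_S4 : S4_axioms L).
Implicit Types w v : canonical_point L.

Lemma point_mp_logic w a b : L (Imp a b) -> w a -> w b.
Proof.
move=> /(point_logic w).
exact: (theory_mp (complete_is_theory (point_complete w))).
Qed.

Lemma accessible_refl w : accessible w w.
Proof. by move=> a; apply/point_mp_logic/(S4_axiom_T L_S4). Qed.

Lemma accessible_trans u v w :
  accessible u v -> accessible v w -> accessible u w.
Proof.
move=> uv vw a ua; apply/vw/uv.
exact: point_mp_logic (S4_axiom_4 L_S4 a) ua.
Qed.

(** Reflexivity and transitivity make the set of points accessible from [w] the
least open neighbourhood of [w]. *)
Lemma canonical_interiorE (A : set (canonical_point L)) w :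
  A° w <-> forall v, accessible w v -> A v.
Proof.
split=> [Aw v wv|wA].
  by apply: interior_subset; exact: (open_interior A) wv Aw.
suff openU : open [set v | accessible w v].
  have /interior_id openUE := openU.
  apply: (@interiorS _ [set v | accessible w v]) => //.
  by rewrite openUE; exact: accessible_refl.
by move=> u v uv wu; exact: accessible_trans uv.
Qed.

(** The formulas [b] with [Box b] in [w] form a theory, by necessitation and K;
it contains the logic and omits [a]. *)
Lemma box_witness w a : ~ w (Box a) -> exists2 v, accessible w v & ~ v a.
Proof.
move=> nwa; pose G : set (formula Atom) := [set b | w (Box b)].
have LG : L `<=` G by move=> b Lb; exact/point_logic/(normal_nec L_normal).
have thG : theory G.
  split=> [b taut|b c Gbc Gb]; first exact/LG/(normal_taut L_normal).
  apply: (theory_mp (complete_is_theory (point_complete w))) Gb.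
  exact: point_mp_logic (normal_K L_normal b c) Gbc.
have [T [cT GT nTa]] := lindenbaum thG nwa.
by exists {| point_complete := cT; point_logic := subset_trans LG GT |}.
Qed.

Definition canonical_valuation (p : Atom) : set (canonical_point L) :=
  [set w | w (Var p)].

Lemma truth_lemma phi :
  truth_set canonical_valuation phi = [set w : canonical_point L | w phi].
Proof.
elim: phi => [p||a IHa|a IHa b IHb|a IHa b IHb|a IHa b IHb|a IHa] //=;
  rewrite ?IHa ?IHb; apply/seteqP; split=> w /=; have cw := point_complete w.
- by [].
- by move=> /(complete_Bot cw).
- by move=> /(complete_Neg cw).
- by move=> /(complete_Neg cw).
- by move=> ?; apply/(complete_And cw).
- by move=> /(complete_And cw).
- by move=> ?; apply/(complete_Or cw).
- by move=> /(complete_Or cw).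
- by move=> ?; apply/(complete_Imp cw).
- by move=> /(complete_Imp cw).
- move=> /canonical_interiorE wa; apply: contrapT => /box_witness[v wv].
  by apply; exact: wa.
- by move=> wa; apply/canonical_interiorE => v; exact.
Qed.

Lemma canonical_completeness phi :
  truth_set canonical_valuation phi = setT -> L phi.
Proof.
rewrite truth_lemma => valid; apply: contrapT => nLphi.
have thL : theory L.
  by split; [exact: (normal_taut L_normal) | exact: (normal_mp L_normal)].
have [T [cT LT nTphi]] := lindenbaum thL nLphi.
pose w : canonical_point L := {| point_complete := cT; point_logic := LT |}.
have : [set w : canonical_point L | w phi] w by rewrite valid.
exact: nTphi.
Qed.

End canonical_model.

(** * Soundness and completeness *)

Theorem theorem4p0p1 (Atom : Type) (L : set (formula Atom))
    (L_normal : normal_logic L) (L_S4 : S4_axioms L) :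
  (forall (X : topologicalType) (V : Atom -> set X) (phi : formula Atom),
     L phi ->
     [/\ forall psi, phi = Box psi -> open (truth_set V phi),
         forall psi, phi = Dia psi -> closed (truth_set V phi),
         truth_set V (Box phi) = interior (truth_set V phi) &
         truth_set V (Dia phi) = closure (truth_set V phi)])
  /\ (forall phi : formula Atom, L phi ->
        S4 phi ->
        forall (X : topologicalType) (V : Atom -> set X),
          satisfies_interpretations V phi)
  /\ (forall phi : formula Atom, L phi ->
        (forall (X : topologicalType) (V : Atom -> set X),
           satisfies_interpretations V phi) ->
        S4 phi).
Proof.
split=> [X V phi _|]; [|split=> [phi _ S4phi X V|phi _ valid]].
- split=> [psi ->|psi ->||]; [exact: open_interior| | by [] |].
    by rewrite truth_set_Dia; exact: closed_closure.
  exact: truth_set_Dia.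
- split=> //; first exact: truth_set_Dia.
    by rewrite (soundness V S4phi) interiorT.
  by rewrite (soundness V S4phi) closureT.
- have [S4_normal S4_S4 _] := S4_least Atom.
  apply: (canonical_completeness S4_normal S4_S4).
  have [_ _ intT _] := valid _ (@canonical_valuation _ (@S4 Atom)).
  by apply/seteqP; split=> // w _; apply: interior_subset; rewrite intT.
Qed.
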